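(* Let $\gamma:\pi\to\pi'$ be a reduction of proof structures. Then $I_{\pi'}=T_\gamma^{-1}(I_\pi)$ or, identifying $P_{\pi'}$ as a subring of $P_\pi$ with inclusion $T_\gamma$, $$I_{\pi'}=I_\pi\cap P_{\pi'} .$$
   Context: **Formulas.** There is an infinite set of unoriented atoms $X,Y,\dots$; an oriented atom is a pair $(X,+)$ or $(X,-)$; $\bar +=-$, $\bar -=+$. Pre-formulas are generated from oriented atoms by $A\otimes B$, $A\wp B$ (par) and $\neg A$. Formulas are pre-formulas modulo the equivalence generated by $\neg(A\otimes B)=\neg B\wp\neg A$, $\neg(A\wp B)=\neg B\otimes\neg A$, $\neg(X,x)=(X,\bar x)$. The sequence of oriented atoms $a(A)$ is determined by: $a((X,x))$ is the one-term sequence $(X,x)$; $a(A\otimes B)=a(A\wp B)$ is the concatenation of $a(A)$ and $a(B)$; $a(\neg A)$ is $a(A)$ reversed with all signs flipped. The set of unoriented atoms $U_A$ has one element for each position of $a(A)$ (repeated atoms give distinct elements). **Proof structures.** A proof structure is a directed multigraph with edges labelled by formulas and vertices labelled $\mathrm{ax},\mathrm{cut},\otimes,\wp,\mathrm c$, where incoming edges of a vertex are its premises and outgoing edges its conclusions, such that: an $\mathrm{ax}$ vertex has no premise and two conclusions labelled $A,\neg A$; a $\mathrm{cut}$ vertex has two premises labelled $A,\neg A$ and no conclusion; a $\otimes$ (resp. $\wp$) vertex has two ordered premises labelled $A$ (left), $B$ (right) and one conclusion labelled $A\otimes B$ (resp. $A\wp B$); a $\mathrm c$ vertex has one premise and no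 conclusion. Links are the vertices not labelled $\mathrm c$. **Polynomial ring and ideal.** Fix a field $k$. $U_\pi$ is the disjoint union over edges $e$ of $\pi$ of the sets $U_{A_e}$, $A_e$ the label of $e$. $P_\pi$ is the polynomial ring (free commutative $k$-algebra) on $U_\pi$. For an ax or cut link $l$ with incident edges labelled $A,\neg A$, if $X_1,\dots,X_n$ are the atoms of $A$ in order and $X_i'\in U_{\neg A}$ is the matching occurrence (at position $n+1-i$), then $G_l=\{X_i-X'_i\}_{i}$. For a $\otimes$ or $\wp$ link with premise atoms $X_1,\dots,X_n$ (left) and $Y_1,\dots,Y_m$ (right) and conclusion atoms $X'_1,\dots,X'_n,Y'_1,\dots,Y'_m$ in order, $G_l=\{X_i-X_i'\}_i\cup\{Y_j-Y'_j\}_j$. $G_\pi=\bigcup_l G_l$ over all links, and $I_\pi=\langle G_\pi\rangle\subseteq P_\pi$. **Reductions.** An $a$-redex is a cut link with premises $e_1$ (labelled $A$) and $e_2$ (labelled $\neg A$), where $e_2$ is a conclusion of an ax link whose other conclusion is an edge $e_3\ne e_1$ labelled $A$; reducing it deletes the cut and ax links and $e_1,e_2,e_3$ and inserts one edge $e$ labelled $A$ from the source of $e_1$ to the target of $e_3$ (in the premise position of $e_3$). An $m$-redex is a cut link whose premises are the conclusion of a $\otimes$ link (premises $e_A,e_B$ labelled $A,B$, conclusion labelled $A\otimes B$) and the conclusion of a $\wp$ link (premises $e_{\neg B},e_{\neg A}$ labelled $\neg B,\neg A$); reducing it deletes these three links and the edges labelled $A\otimes B$ and $\neg B\wp\neg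 A$ and inserts two cut links, one with premises $e_A,e_{\neg A}$ and one with premises $e_B,e_{\neg B}$. A reduction $\gamma:\pi\to\pi'$ is a redex in $\pi$ whose reduction yields $\pi'$. The $k$-algebra map $T_\gamma:P_{\pi'}\to P_\pi$ sends atoms on the new edge $e$ ($a$-redex) to the corresponding atoms on $e_3$, and all other atoms (including those of $e_A,e_B,e_{\neg A},e_{\neg B}$ for an $m$-redex) to themselves. *)

(* Defs.v *)
From HB Require Import structures.
From mathcomp Require Import all_boot all_algebra.
From mathcomp Require Import finmap.
From mathcomp.multinomials Require Import monalg.

Set Implicit Arguments.
Unset Strict Implicit.
Unset Printing Implicit Defensive.

Import GRing.Theory.

Local Open Scope ring_scope.
Local Open Scope quotient_scope.

Section Preformula.
Context (At : choiceType).

(* The sign of an oriented atom [(X, x)] is a boolean: [true] for [+],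
   [false] for [-]. *)
Inductive preformula :=
| PAtom (X : At) (x : bool)
| PTens (A B : preformula)
| PPar (A B : preformula)
| PNeg (A : preformula).

Inductive pf_equiv : preformula -> preformula -> Prop :=
| pf_neg_tens A B : pf_equiv (PNeg (PTens A B)) (PPar (PNeg B) (PNeg A))
| pf_neg_par A B : pf_equiv (PNeg (PPar A B)) (PTens (PNeg B) (PNeg A))
| pf_neg_atom X x : pf_equiv (PNeg (PAtom X x)) (PAtom X (~~ x))
| pf_refl A : pf_equiv A A
| pf_sym A B : pf_equiv A B -> pf_equiv B A
| pf_trans A B C : pf_equiv A B -> pf_equiv B C -> pf_equiv A C
| pf_tens A A' B B' :
    pf_equiv A A' -> pf_equiv B B' -> pf_equiv (PTens A B) (PTens A' B')
| pf_par A A' B B' :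
    pf_equiv A A' -> pf_equiv B B' -> pf_equiv (PPar A B) (PPar A' B')
| pf_neg A A' : pf_equiv A A' -> pf_equiv (PNeg A) (PNeg A').

Fixpoint pf_atoms (A : preformula) : seq (At * bool) :=
  match A with
  | PAtom X x => [:: (X, x)]
  | PTens A B | PPar A B => pf_atoms A ++ pf_atoms B
  | PNeg A => [seq (Xx.1, ~~ Xx.2) | Xx <- rev (pf_atoms A)]
  end.

(* Negation normal form: it decides [pf_equiv], see [pf_equivP] below.
   [pf_nf s A] is the normal form of [A] if [s] is [false], and of
   [PNeg A] if [s] is [true]. *)
Fixpoint pf_nf (s : bool) (A : preformula) : preformula :=
  match A with
  | PAtom X x => PAtom X (s (+) x)
  | PTens A B => if s then PPar (pf_nf s B) (pf_nf s A)
                 else PTens (pf_nf s A) (pf_nf s B)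
  | PPar A B => if s then PTens (pf_nf s B) (pf_nf s A)
                else PPar (pf_nf s A) (pf_nf s B)
  | PNeg A => pf_nf (~~ s) A
  end.

Fixpoint pf_encode (A : preformula) : GenTree.tree (At * bool) :=
  match A with
  | PAtom X x => GenTree.Leaf (X, x)
  | PTens A B => GenTree.Node 0 [:: pf_encode A; pf_encode B]
  | PPar A B => GenTree.Node 1 [:: pf_encode A; pf_encode B]
  | PNeg A => GenTree.Node 2 [:: pf_encode A]
  end.

Fixpoint pf_decode (t : GenTree.tree (At * bool)) : option preformula :=
  match t with
  | GenTree.Leaf (X, x) => Some (PAtom X x)
  | GenTree.Node 0 [:: t; u] =>
      if (pf_decode t, pf_decode u) is (Some A, Some B)
      then Some (PTens A B) else None
  | GenTree.Node 1 [:: t; u] =>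
      if (pf_decode t, pf_decode u) is (Some A, Some B)
      then Some (PPar A B) else None
  | GenTree.Node 2 [:: t] => omap PNeg (pf_decode t)
  | _ => None
  end.

Lemma pf_encodeK : pcancel pf_encode pf_decode.
Proof. by elim=> //= [A -> B ->|A -> B ->|A ->]. Qed.

HB.instance Definition _ := Choice.copy preformula (pcan_type pf_encodeK).

Lemma pf_nf_sound A :
  pf_equiv A (pf_nf false A) /\ pf_equiv (PNeg A) (pf_nf true A).
Proof.
elim: A => [X x|A [A1 A2] B [B1 B2]|A [A1 A2] B [B1 B2]|A [A1 A2]] /=.
- by split; [apply: pf_refl|apply: pf_neg_atom].
- split; first exact: pf_tens.
  by apply: pf_trans (pf_neg_tens _ _) _; apply: pf_par.
- split; first exact: pf_par.
  by apply: pf_trans (pf_neg_par _ _) _; apply: pf_tens.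
split=> //; apply: pf_trans (pf_neg A2) _.
have {A2} : forall s B, pf_equiv (PNeg (pf_nf s B)) (pf_nf (~~ s) B).
  move=> s B; elim: B s => [X x|B IB C IC|B IB C IC|B IB] s /=.
  - by rewrite addNb; apply: pf_neg_atom.
  - by case: s => /=; [apply: pf_trans (pf_neg_par _ _) _; apply: pf_tens
                      |apply: pf_trans (pf_neg_tens _ _) _; apply: pf_par].
  - by case: s => /=; [apply: pf_trans (pf_neg_tens _ _) _; apply: pf_par
                      |apply: pf_trans (pf_neg_par _ _) _; apply: pf_tens].
  by apply: IB.
by move/(_ true A).
Qed.

Lemma pf_nf_complete A B s : pf_equiv A B -> pf_nf s A = pf_nf s B.
Proof.
move=> eAB; elim: eAB s => {A B} //=.
- by move=> A B [].
- by move=> A B [].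
- by move=> X x s; rewrite addNb addbN.
- by move=> A B C _ IAB _ IBC s; rewrite IAB.
- by move=> A A' B B' _ IA _ IB s; rewrite IA IB.
by move=> A A' B B' _ IA _ IB s; rewrite IA IB.
Qed.

Definition pf_equivb : rel preformula :=
  [rel A B | pf_nf false A == pf_nf false B].

Lemma pf_equivP A B : reflect (pf_equiv A B) (pf_equivb A B).
Proof.
apply: (iffP eqP) => [eAB|/pf_nf_complete->//].
apply: pf_trans (pf_nf_sound A).1 _; rewrite eAB.
exact: pf_sym (pf_nf_sound B).1.
Qed.

Lemma pf_equivb_refl : reflexive pf_equivb.
Proof. by move=> A; apply: eqxx. Qed.
Lemma pf_equivb_sym : symmetric pf_equivb.
Proof. by move=> A B; apply: eq_sym. Qed.
Lemma pf_equivb_trans : transitive pf_equivb.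
Proof. by move=> B A C; rewrite /pf_equivb /= => /eqP-> /eqP->. Qed.

Canonical pf_equivb_equiv :=
  EquivRel pf_equivb pf_equivb_refl pf_equivb_sym pf_equivb_trans.

Definition formula := {eq_quot pf_equivb}.

HB.instance Definition _ := Choice.on formula.
HB.instance Definition _ : EqQuotient _ pf_equivb formula :=
  EqQuotient.on formula.

Definition tens (A B : formula) : formula :=
  \pi_formula (PTens (repr A) (repr B)).
Definition par (A B : formula) : formula :=
  \pi_formula (PPar (repr A) (repr B)).
Definition neg (A : formula) : formula := \pi_formula (PNeg (repr A)).
Definition atoms (A : formula) : seq (At * bool) := pf_atoms (repr A).

Lemma pi_formulaP (A B : preformula) :
  \pi_formula A = \pi_formula B <-> pf_equiv A B.
Proof. by split=> [/eqmodP/pf_equivP|/pf_equivP/eqmodP]. Qed.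

Lemma repr_pi_formula (A : preformula) : pf_equiv (repr (\pi_formula A)) A.
Proof. by apply/pi_formulaP; rewrite reprK. Qed.

Lemma pi_tens A B :
  \pi_formula (PTens A B) = tens (\pi_formula A) (\pi_formula B).
Proof.
by apply/pi_formulaP/pf_sym/pf_tens; apply: repr_pi_formula.
Qed.

Lemma pi_par A B :
  \pi_formula (PPar A B) = par (\pi_formula A) (\pi_formula B).
Proof.
by apply/pi_formulaP/pf_sym/pf_par; apply: repr_pi_formula.
Qed.

Lemma pi_neg A : \pi_formula (PNeg A) = neg (\pi_formula A).
Proof. by apply/pi_formulaP/pf_sym/pf_neg; apply: repr_pi_formula. Qed.

Lemma neg_tens A B : neg (tens A B) = par (neg B) (neg A).
Proof.
rewrite -[A]reprK -[B]reprK -pi_tens -!pi_neg -pi_par.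
exact/pi_formulaP/pf_neg_tens.
Qed.

Lemma neg_par A B : neg (par A B) = tens (neg B) (neg A).
Proof.
rewrite -[A]reprK -[B]reprK -pi_par -!pi_neg -pi_tens.
exact/pi_formulaP/pf_neg_par.
Qed.

Lemma negK : involutive neg.
Proof.
move=> A; rewrite -[A]reprK -!pi_neg; apply/pi_formulaP/pf_equivP.
by rewrite /pf_equivb /= reprK.
Qed.

Lemma pf_atoms_equiv A B : pf_equiv A B -> pf_atoms A = pf_atoms B.
Proof.
elim=> {A B} //=.
- by move=> A B; rewrite rev_cat map_cat.
- by move=> A B; rewrite rev_cat map_cat.
- by move=> A B C _ -> _ ->.
- by move=> A A' B B' _ -> _ ->.
- by move=> A A' B B' _ -> _ ->.
by move=> A A' _ ->.
Qed.

Lemma atoms_pi A : atoms (\pi_formula A) = pf_atoms A.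
Proof. exact/pf_atoms_equiv/repr_pi_formula. Qed.

Lemma atoms_tens A B : atoms (tens A B) = atoms A ++ atoms B.
Proof. exact: atoms_pi. Qed.

Lemma atoms_par A B : atoms (par A B) = atoms A ++ atoms B.
Proof. exact: atoms_pi. Qed.

Lemma atoms_neg A :
  atoms (neg A) = [seq (Xx.1, ~~ Xx.2) | Xx <- rev (atoms A)].
Proof. exact: atoms_pi. Qed.

Lemma size_atoms_neg A : size (atoms (neg A)) = size (atoms A).
Proof. by rewrite atoms_neg size_map size_rev. Qed.

(* The set of unoriented atoms of [A]: one element per position of
   [atoms A], numbered from 0. *)
Definition uatoms (A : formula) : choiceType := 'I_(size (atoms A)).

End Preformula.

Variant vlabel := Ax | Cut | Tens | Par | Concl.

(* [prem_left e] is only meaningful if the target of [e] is a tensor or par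
   vertex, where it says whether [e] is the left premise of that vertex. *)
Record graph (At : choiceType) := Graph {
  vert : choiceType;
  edge : choiceType;
  vlab : vert -> vlabel;
  lab : edge -> formula At;
  src : edge -> vert;
  tgt : edge -> vert;
  prem_left : edge -> bool
}.

Section ProofStructure.
Context (At : choiceType).
Implicit Types (G : graph At).

(* The premises (resp. conclusions) of [v] are the edges listed in [s],
   irrespective of the order, and these are pairwise distinct. *)
Definition premises G (v : vert G) (s : seq (edge G)) : Prop :=
  uniq s /\ forall e, (e \in s) = (tgt e == v).

Definition conclusions G (v : vert G) (s : seq (edge G)) : Prop :=
  uniq s /\ forall e, (e \in s) = (src e == v).

Definition lr_premises G (v : vert G) (eL eR : edge G) : Prop :=
  [/\ premises v [:: eL; eR], prem_left eL & ~~ prem_left eR].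

Definition wf_vertex G (v : vert G) : Prop :=
  match vlab v with
  | Ax => premises v [::] /\
      exists e e', conclusions v [:: e; e'] /\ lab e' = neg (lab e)
  | Cut => conclusions v [::] /\
      exists e e', premises v [:: e; e'] /\ lab e' = neg (lab e)
  | Tens => exists eL eR e, [/\ lr_premises v eL eR, conclusions v [:: e]
      & lab e = tens (lab eL) (lab eR)]
  | Par => exists eL eR e, [/\ lr_premises v eL eR, conclusions v [:: e]
      & lab e = par (lab eL) (lab eR)]
  | Concl => conclusions v [::] /\ exists e, premises v [:: e]
  end.

Record proof_structure := ProofStructure {
  ps_graph :> graph At;
  ps_wf : forall v : vert ps_graph, wf_vertex v
}.

End ProofStructure.

(* The free commutative [k]-algebra on a set [I], possibly infinite. *)
Notation freealg k I := {malg k[{cmonom I}]}.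

Section Polynomials.
Context (k : fieldType).

Definition pvar (I : choiceType) (i : I) : freealg k I := << ucm i >>.

Section Eval.
Context (I J : choiceType) (h : I -> freealg k J).

Definition mon_eval (m : {cmonom I}) : freealg k J :=
  \prod_(i <- finsupp m) h i ^+ m i.

Lemma mon_evalw (d : {fset I}) (m : {cmonom I}) :
  (finsupp m `<=` d)%fset -> mon_eval m = \prod_(i <- d) h i ^+ m i.
Proof.
move=> le; rewrite /mon_eval (big_fset_incl _ le) // => i _.
by rewrite -cmE_eq0 => /eqP->; rewrite expr0.
Qed.

Lemma mon_eval_is_mmorphism : mmorphism mon_eval.
Proof.
split=> [m1 m2|]; last by rewrite /mon_eval mdom1 big_seq_fset0.
rewrite (mon_evalw (d := (finsupp m1 `|` finsupp m2)%fset)) ?mdomD //.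
rewrite (mon_evalw (fsubsetUl _ (finsupp m2))).
rewrite (mon_evalw (fsubsetUr (finsupp m1) _)) -big_split /=.
by apply: eq_bigr => i _; rewrite cmM exprD.
Qed.

HB.instance Definition _ :=
  isMultiplicative.Build _ _ mon_eval mon_eval_is_mmorphism.

Definition poly_eval : freealg k I -> freealg k J :=
  mmap (@malgC _ k) mon_eval.

HB.instance Definition _ := GRing.RMorphism.on poly_eval.

Lemma poly_eval_is_scalable : scalable poly_eval.
Proof.
by move=> c p; rewrite -mul_malgC rmorphM /= /poly_eval mmapC mul_malgC.
Qed.

HB.instance Definition _ :=
  GRing.isScalable.Build k (freealg k I) (freealg k J) *:%R poly_eval
    poly_eval_is_scalable.

Lemma poly_eval_pvar i : poly_eval (pvar i) = h i.
Proof.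
rewrite /poly_eval /pvar mmapU /= mpolyC1E mul1r /mon_eval.
by rewrite mdomU big_seq_fset1 cmUU expr1.
Qed.

End Eval.
End Polynomials.

Definition ideal_gen (R : comNzRingType) (S : R -> Prop) (p : R) : Prop :=
  exists n (c g : 'I_n -> R),
    (forall i, S (g i)) /\ p = \sum_(i < n) c i * g i.

Section Ideal.
Context (At : choiceType) (k : fieldType).
Implicit Types (G : graph At).

Definition U_ps G : choiceType := {e : edge G & uatoms (lab e)}.

Definition P_ps G := freealg k (U_ps G).

Definition X_at G (e : edge G) (x : uatoms (lab e)) : P_ps G :=
  pvar k (Tagged (fun e => uatoms (lab e)) x : U_ps G).

(* Positions being numbered from 0, the occurrence matching position [x] of
   [A] is the position [x'] of [neg A] such that [x + x' + 1] is the length of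
   [atoms A]. *)
Definition G_match G (e e' : edge G) (p : P_ps G) : Prop :=
  exists (x : uatoms (lab e)) (x' : uatoms (lab e')),
    (x + x').+1 = size (atoms (lab e)) /\ p = X_at x - X_at x'.

(* For ax and cut links, neither of the two edges [e], [e'] is distinguished
   since [neg] is involutive: generators appear with both signs. *)
Definition G_link G (l : vert G) (p : P_ps G) : Prop :=
  match vlab l with
  | Ax => exists e e', [/\ conclusions l [:: e; e'],
      lab e' = neg (lab e) & G_match e e' p]
  | Cut => exists e e', [/\ premises l [:: e; e'],
      lab e' = neg (lab e) & G_match e e' p]
  | Tens | Par => exists eL eR e, [/\ lr_premises l eL eR,
      conclusions l [:: e] &
      (exists (x : uatoms (lab eL)) (x' : uatoms (lab e)),
        x' = x :> nat /\ p = X_at x - X_at x') \/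
      (exists (y : uatoms (lab eR)) (y' : uatoms (lab e)),
        y' = (size (atoms (lab eL)) + y)%N :> nat /\ p = X_at y - X_at y')]
  | Concl => False
  end.

Definition G_ps G (p : P_ps G) : Prop := exists l : vert G, G_link l p.

Definition I_ps G : P_ps G -> Prop := ideal_gen (@G_ps G).

End Ideal.

Section Reduction.
Context (At : choiceType).

Record a_redex (G : graph At) := ARedex {
  ar_cut : vert G;
  ar_ax : vert G;
  ar_e1 : edge G;
  ar_e2 : edge G;
  ar_e3 : edge G;
  ar_A : formula At;
  ar_vlab_cut : vlab ar_cut = Cut;
  ar_vlab_ax : vlab ar_ax = Ax;
  ar_prem_cut : premises ar_cut [:: ar_e1; ar_e2];
  ar_concl_ax : conclusions ar_ax [:: ar_e2; ar_e3];
  ar_neq31 : ar_e3 != ar_e1;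
  ar_lab1 : lab ar_e1 = ar_A;
  ar_lab2 : lab ar_e2 = neg ar_A;
  ar_lab3 : lab ar_e3 = ar_A
}.

Record m_redex (G : graph At) := MRedex {
  mr_cut : vert G;
  mr_tens : vert G;
  mr_par : vert G;
  mr_eT : edge G;
  mr_eP : edge G;
  mr_eA : edge G;
  mr_eB : edge G;
  mr_enB : edge G;
  mr_enA : edge G;
  mr_A : formula At;
  mr_B : formula At;
  mr_vlab_cut : vlab mr_cut = Cut;
  mr_vlab_tens : vlab mr_tens = Tens;
  mr_vlab_par : vlab mr_par = Par;
  mr_prem_cut : premises mr_cut [:: mr_eT; mr_eP];
  mr_concl_tens : conclusions mr_tens [:: mr_eT];
  mr_concl_par : conclusions mr_par [:: mr_eP];
  mr_prem_tens : lr_premises mr_tens mr_eA mr_eB;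
  mr_prem_par : lr_premises mr_par mr_enB mr_enA;
  mr_labT : lab mr_eT = tens mr_A mr_B;
  mr_labP : lab mr_eP = par (neg mr_B) (neg mr_A);
  mr_labA : lab mr_eA = mr_A;
  mr_labB : lab mr_eB = mr_B;
  mr_labnB : lab mr_enB = neg mr_B;
  mr_labnA : lab mr_enA = neg mr_A
}.

Lemma cut_src (p : proof_structure At) (v : vert p) e :
  vlab v = Cut -> (src e == v) = false.
Proof.
by move=> vC; have := ps_wf v; rewrite /wf_vertex vC => -[[_ <-]].
Qed.

Lemma ax_tgt (p : proof_structure At) (v : vert p) e :
  vlab v = Ax -> (tgt e == v) = false.
Proof.
by move=> vA; have := ps_wf v; rewrite /wf_vertex vA => -[[_ <-]].
Qed.

Section AReduct.
Context (p : proof_structure At) (r : a_redex p).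

Let e1 := ar_e1 r.
Let e2 := ar_e2 r.
Let e3 := ar_e3 r.

(* [None] is the new edge: it has the source of [e1], and the label, target
   and premise position of [e3]. *)
Definition ar_vert : choiceType :=
  {v : vert p | v \notin [:: ar_cut r; ar_ax r]}.
Definition ar_edge : choiceType :=
  option {e : edge p | e \notin [:: ar_e1 r; ar_e2 r; ar_e3 r]}.

Definition ar_src_edge (e : ar_edge) : edge p := oapp val (ar_e1 r) e.
Definition ar_tgt_edge (e : ar_edge) : edge p := oapp val (ar_e3 r) e.

Lemma ar_src_subproof e : src (ar_src_edge e) \notin [:: ar_cut r; ar_ax r].
Proof.
rewrite !inE negb_or (cut_src _ (ar_vlab_cut r)) /=.
have [_ <-] := ar_concl_ax r; case: e => [[e /=]|] /=.
  by rewrite !inE !negb_or => /and3P[_ -> ->].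
have [/= + _] := ar_prem_cut r; rewrite !inE negb_or => /andP[-> _] /=.
by rewrite eq_sym ar_neq31.
Qed.

Lemma ar_tgt_subproof e : tgt (ar_tgt_edge e) \notin [:: ar_cut r; ar_ax r].
Proof.
rewrite !inE negb_or (ax_tgt _ (ar_vlab_ax r)) andbT.
have [_ <-] := ar_prem_cut r; case: e => [[e /=]|] /=.
  by rewrite !inE !negb_or => /and3P[-> -> _].
have [/= + _] := ar_concl_ax r; rewrite !inE negb_or ar_neq31 /=.
by rewrite eq_sym => /andP[].
Qed.

Definition a_reduct_graph : graph At := {|
  vert := ar_vert;
  edge := ar_edge;
  vlab := fun v => vlab (val v);
  lab := fun e => lab (ar_tgt_edge e);
  src := fun e => Sub (src (ar_src_edge e)) (ar_src_subproof e);
  tgt := fun e => Sub (tgt (ar_tgt_edge e)) (ar_tgt_subproof e);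
  prem_left := fun e => prem_left (ar_tgt_edge e)
|}.

(* [ins e] is the edge of the reduct corresponding to [e]. *)
Let ins (e : edge p) : edge a_reduct_graph := insub e.

Let insK_tgt e : e != e1 -> e != e2 -> ar_tgt_edge (ins e) = e.
Proof.
move=> n1 n2; rewrite /ins /ar_tgt_edge; case: insubP => [u _ <-//|] /=.
by rewrite !inE (negPf n1) (negPf n2) negbK => /eqP.
Qed.

Let insK_src e : e != e2 -> e != e3 -> ar_src_edge (ins e) = e.
Proof.
move=> n2 n3; rewrite /ins /ar_src_edge; case: insubP => [u _ <-//|] /=.
by rewrite !inE (negPf n2) (negPf n3) negbK !orbF => /eqP.
Qed.

Let tgtK (e : edge a_reduct_graph) : ins (ar_tgt_edge e) = e.
Proof.
rewrite /ins; case: e => [u|] /=; first by rewrite valK.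
by rewrite insubF // !inE eqxx !orbT.
Qed.

Let srcK (e : edge a_reduct_graph) : ins (ar_src_edge e) = e.
Proof.
rewrite /ins; case: e => [u|] /=; first by rewrite valK.
by rewrite insubF // !inE eqxx.
Qed.

Let tgtP (v : vert a_reduct_graph) e :
  tgt e = val v -> (e != e1) * (e != e2).
Proof.
move=> te; have := valP v; rewrite -te !inE negb_or => /andP[+ _].
by have [_ <-] := ar_prem_cut r; rewrite !inE negb_or => /andP[-> ->].
Qed.

Let srcP (v : vert a_reduct_graph) e :
  src e = val v -> (e != e2) * (e != e3).
Proof.
move=> te; have := valP v; rewrite -te !inE negb_or => /andP[_].
by have [_ <-] := ar_concl_ax r; rewrite !inE negb_or => /andP[-> ->].
Qed.

Let lab_ins e : e != e2 -> lab (ins e) = lab e.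
Proof.
move=> n2 /=; have [->|n1] := eqVneq e e1; last by rewrite insK_tgt.
rewrite /ins insubF ?inE ?eqxx //= -/e1.
by rewrite (ar_lab3 r) (ar_lab1 r).
Qed.

Let prem_ins (v : vert a_reduct_graph) s :
  premises (val v) s -> premises v (map ins s).
Proof.
move=> [us sP]; have sK : {in s, cancel ins ar_tgt_edge}.
  by move=> e; rewrite sP => /eqP/tgtP[] *; apply: insK_tgt.
split; first by rewrite map_inj_in_uniq //; apply: can_in_inj sK.
move=> e; rewrite -val_eqE /= -sP; apply/mapP/idP => [[f fs ->]|es].
  by rewrite sK.
by exists (ar_tgt_edge e); rewrite ?tgtK.
Qed.

Let concl_ins (v : vert a_reduct_graph) s :
  conclusions (val v) s -> conclusions v (map ins s).
Proof.
move=> [us sP]; have sK : {in s, cancel ins ar_src_edge}.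
  by move=> e; rewrite sP => /eqP/srcP[] *; apply: insK_src.
split; first by rewrite map_inj_in_uniq //; apply: can_in_inj sK.
move=> e; rewrite -val_eqE /= -sP; apply/mapP/idP => [[f fs ->]|es].
  by rewrite sK.
by exists (ar_src_edge e); rewrite ?srcK.
Qed.

Let lab_prem (v : vert a_reduct_graph) s e :
  premises (val v) s -> e \in s -> lab (ins e) = lab e.
Proof. by move=> [_ ->] /eqP/tgtP[_]; apply: lab_ins. Qed.

Let lab_concl (v : vert a_reduct_graph) s e :
  conclusions (val v) s -> e \in s -> lab (ins e) = lab e.
Proof. by move=> [_ ->] /eqP/srcP[+ _]; apply: lab_ins. Qed.

Let lr_ins (v : vert a_reduct_graph) eL eR :
  lr_premises (val v) eL eR -> lr_premises v (ins eL) (ins eR).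
Proof.
move=> [sP lL lR]; split; first exact: (prem_ins sP).
  have [_ sE] := sP; have : eL \in [:: eL; eR] by rewrite !inE eqxx.
  by rewrite sE => /eqP/tgtP[n1 n2] /=; rewrite insK_tgt.
have [_ sE] := sP; have : eR \in [:: eL; eR] by rewrite !inE eqxx orbT.
by rewrite sE => /eqP/tgtP[n1 n2] /=; rewrite insK_tgt.
Qed.

Lemma a_reduct_wf v : @wf_vertex At a_reduct_graph v.
Proof.
have := ps_wf (val v); rewrite /wf_vertex [vlab v]/=.
case: (vlab (val v)) => [[pv]|[cv]|||[cv]].
- case=> [e [e' [cv le]]]; split; first exact: (prem_ins pv).
  exists (ins e), (ins e'); split; first exact: (concl_ins cv).
  by rewrite !(lab_concl cv) ?inE ?eqxx ?orbT.
- case=> [e [e' [pv le]]]; split; first exact: (concl_ins cv).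
  exists (ins e), (ins e'); split; first exact: (prem_ins pv).
  by rewrite !(lab_prem pv) ?inE ?eqxx ?orbT.
- case=> [eL [eR [e [pv cv le]]]]; exists (ins eL), (ins eR), (ins e).
  split; [exact: lr_ins|exact: (concl_ins cv)|case: pv => pv _ _].
  by rewrite (lab_concl cv) ?(lab_prem pv) ?inE ?eqxx ?orbT.
- case=> [eL [eR [e [pv cv le]]]]; exists (ins eL), (ins eR), (ins e).
  split; [exact: lr_ins|exact: (concl_ins cv)|case: pv => pv _ _].
  by rewrite (lab_concl cv) ?(lab_prem pv) ?inE ?eqxx ?orbT.
case=> [e pv]; split; first exact: (concl_ins cv).
by exists (ins e); apply: (prem_ins pv).
Qed.

Definition a_reduct : proof_structure At := ProofStructure a_reduct_wf.

End AReduct.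

Section MReduct.
Context (p : proof_structure At) (r : m_redex p).

(* [inr true] and [inr false] are the new cut links, with premises labelled
   [A], [neg A] and [B], [neg B] respectively. *)
Definition mr_vert : choiceType :=
  ({v : vert p | v \notin [:: mr_cut r; mr_tens r; mr_par r]} + bool)%type.
Definition mr_edge : choiceType :=
  {e : edge p | e \notin [:: mr_eT r; mr_eP r]}.

Lemma mr_src_subproof (e : mr_edge) :
  src (val e) \notin [:: mr_cut r; mr_tens r; mr_par r].
Proof.
rewrite !inE !negb_or (cut_src _ (mr_vlab_cut r)) /=.
have [_ <-] := mr_concl_tens r; have [_ <-] := mr_concl_par r.
by have := valP e; rewrite !inE negb_or.
Qed.

Definition mr_tgt (e : mr_edge) : mr_vert :=
  match insub (tgt (val e)) with
  | Some v => inl v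
  | None => inr (val e \in [:: mr_eA r; mr_enA r])
  end.

Definition m_reduct_graph : graph At := {|
  vert := mr_vert;
  edge := mr_edge;
  vlab := fun v => if v is inl v then vlab (val v) else Cut;
  lab := fun e => lab (val e);
  src := fun e => inl (Sub (src (val e)) (mr_src_subproof e));
  tgt := mr_tgt;
  prem_left := fun e => prem_left (val e)
|}.

Let prem_lift
    (v : {v : vert p | v \notin [:: mr_cut r; mr_tens r; mr_par r]}) s :
  premises (val v) s ->
  exists2 s', map val s' = s & @premises At m_reduct_graph (inl v) s'.
Proof.
move=> [us sP]; have sQ : all (fun e => e \notin [:: mr_eT r; mr_eP r]) s.
  apply/allP => e; rewrite sP => /eqP te; have := valP v.
  rewrite -te !inE !negb_or => /and3P[+ _ _].
  by have [_ <-] := mr_prem_cut r; rewrite !inE negb_or.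
have vK : map val (pmap insub s : seq mr_edge) = s.
  rewrite pmap_filter; last exact: insubK.
  apply/all_filterP/allP => e es; rewrite isSome_insub.
  exact: (allP sQ).
exists (pmap insub s) => //; split; first by rewrite -(map_inj_uniq val_inj) vK.
move=> e; rewrite -(mem_map val_inj) vK sP /= /mr_tgt.
case: insubP => [u _ <-|]; first by rewrite (inj_eq val_inj).
move=> n; apply/negbTE; apply: contra n => /eqP->; exact: (valP v).
Qed.

Let concl_lift
    (v : {v : vert p | v \notin [:: mr_cut r; mr_tens r; mr_par r]}) s :
  conclusions (val v) s ->
  exists2 s', map val s' = s & @conclusions At m_reduct_graph (inl v) s'.
Proof.
move=> [us sP]; have sQ : all (fun e => e \notin [:: mr_eT r; mr_eP r]) s.
  apply/allP => e; rewrite sP => /eqP te; have := valP v.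
  rewrite -te !inE !negb_or => /and3P[_].
  by have [_ <-] := mr_concl_tens r; have [_ <-] := mr_concl_par r;
    rewrite !inE => -> ->.
have vK : map val (pmap insub s : seq mr_edge) = s.
  rewrite pmap_filter; last exact: insubK.
  apply/all_filterP/allP => e es; rewrite isSome_insub.
  exact: (allP sQ).
exists (pmap insub s) => //; split; first by rewrite -(map_inj_uniq val_inj) vK.
move=> e; rewrite -(mem_map val_inj) vK sP /=.
by apply: (inj_eq val_inj (Sub _ _) v).
Qed.

Let cut_tgt e : tgt e = mr_tens r \/ tgt e = mr_par r ->
  e \notin [:: mr_eT r; mr_eP r].
Proof.
have [_ ->] := mr_prem_cut r => -[]->; apply: contraTneq isT => ve.
  by have := mr_vlab_tens r; rewrite ve mr_vlab_cut.
by have := mr_vlab_par r; rewrite ve mr_vlab_cut.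
Qed.

Let tens_par : mr_tens r != mr_par r.
Proof.
apply: contraTneq isT => ve.
by have := mr_vlab_tens r; rewrite ve mr_vlab_par.
Qed.

Let tgtA : tgt (mr_eA r) = mr_tens r.
Proof.
by have [[_ sP] _ _] := mr_prem_tens r; apply/eqP; rewrite -sP !inE eqxx.
Qed.
Let tgtB : tgt (mr_eB r) = mr_tens r.
Proof.
by have [[_ sP] _ _] := mr_prem_tens r; apply/eqP; rewrite -sP !inE eqxx orbT.
Qed.
Let tgtnA : tgt (mr_enA r) = mr_par r.
Proof.
by have [[_ sP] _ _] := mr_prem_par r; apply/eqP; rewrite -sP !inE eqxx orbT.
Qed.
Let tgtnB : tgt (mr_enB r) = mr_par r.
Proof.
by have [[_ sP] _ _] := mr_prem_par r; apply/eqP; rewrite -sP !inE eqxx.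
Qed.

Let mr_tgt_inr (e : mr_edge) b : (inr b == mr_tgt e) =
  (val e \in if b then [:: mr_eA r; mr_enA r] else [:: mr_eB r; mr_enB r]).
Proof.
have nAB : mr_eA r != mr_eB r.
  by have [[/= + _] _ _] := mr_prem_tens r; rewrite !inE andbT.
have nAB' : mr_enB r != mr_enA r.
  by have [[/= + _] _ _] := mr_prem_par r; rewrite !inE andbT.
have nX f g : tgt f = mr_tens r -> tgt g = mr_par r -> (f == g) = false.
  by move=> tf tg; apply: contraNF tens_par => /eqP fg; rewrite -tf -tg fg.
rewrite /mr_tgt; case: insubP => [u uP ue|].
  apply/esym/negbTE; apply: contraL uP => ve; rewrite negbK.
  by case: b ve; rewrite !inE => /orP[]/eqP->;
    rewrite ?tgtA ?tgtB ?tgtnA ?tgtnB eqxx ?orbT.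
rewrite negbK !inE; have [_ <-] := mr_prem_cut r.
rewrite (negPf (valP e)) /=.
have [[_ <-] _ _] := mr_prem_tens r; have [[_ <-] _ _] := mr_prem_par r.
rewrite !inE (inj_eq (@inr_inj _ _)).
have nX' f g : tgt f = mr_tens r -> tgt g = mr_par r -> (g == f) = false.
  by move=> tf tg; rewrite eq_sym nX.
have nBA := nAB; rewrite eq_sym in nBA.
have nBA' := nAB'; rewrite eq_sym in nBA'.
have E := (negPf nAB, negPf nAB', negPf nBA, negPf nBA', nX _ _ tgtA tgtnA,
  nX _ _ tgtA tgtnB, nX _ _ tgtB tgtnA, nX _ _ tgtB tgtnB,
  nX' _ _ tgtA tgtnA, nX' _ _ tgtA tgtnB, nX' _ _ tgtB tgtnA,
  nX' _ _ tgtB tgtnB, eqxx).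
by case/orP=> /orP[]/eqP->; case: b; rewrite !inE !E.
Qed.

Lemma m_reduct_wf v : @wf_vertex At m_reduct_graph v.
Proof.
case: v => [v|b]; rewrite /wf_vertex [vlab _]/=; last first.
  split; first by split.
  have [eAQ eBQ] : mr_eA r \notin [:: mr_eT r; mr_eP r] /\
      mr_eB r \notin [:: mr_eT r; mr_eP r].
    by split; apply: cut_tgt; left.
  have [enAQ enBQ] : mr_enA r \notin [:: mr_eT r; mr_eP r] /\
      mr_enB r \notin [:: mr_eT r; mr_eP r].
    by split; apply: cut_tgt; right.
  have nX f g : tgt f = mr_tens r -> tgt g = mr_par r -> (f == g) = false.
    by move=> tf tg; apply: contraNF tens_par => /eqP fg; rewrite -tf -tg fg.
  pose sub e (eQ : e \notin [:: mr_eT r; mr_eP r]) : edge m_reduct_graph :=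
    exist (fun e => is_true (e \notin [:: mr_eT r; mr_eP r])) e eQ.
  case: b; [exists (sub _ eAQ), (sub _ enAQ)|exists (sub _ eBQ), (sub _ enBQ)].
    split; last by rewrite /= mr_labnA mr_labA.
    split; first by rewrite /= !inE andbT -val_eqE /= nX.
    by move=> e; rewrite eq_sym mr_tgt_inr !inE -!val_eqE.
  split; last by rewrite /= mr_labnB mr_labB.
  split; first by rewrite /= !inE andbT -val_eqE /= nX.
  by move=> e; rewrite eq_sym mr_tgt_inr !inE -!val_eqE.
have := ps_wf (val v); rewrite /wf_vertex.
have lift3 eL eR e : lr_premises (val v) eL eR -> conclusions (val v) [:: e] ->
    exists fL fR f : edge m_reduct_graph,
    [/\ lr_premises (inl v : vert m_reduct_graph) fL fR,
        conclusions (inl v : vert m_reduct_graph) [:: f] &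
     [/\ val fL = eL, val fR = eR & val f = e]].
  move=> [pv lL lR] cv.
  have [[|fL [|fR []]] //= [? ?] pv'] := prem_lift pv.
  have [[|f []] //= [?] cv'] := concl_lift cv.
  by exists fL, fR, f; split=> //; subst; split.
case: (vlab (val v)) => [[pv]|[cv]|||[cv]].
- case=> [e [e' [cv le]]]; split.
    by have [[|//] _ ?] := prem_lift pv.
  have [[|f [|f' []]] //= [ef ef'] cv'] := concl_lift cv.
  by exists f, f'; split=> //=; rewrite ef ef'.
- case=> [e [e' [pv le]]]; split.
    by have [[|//] _ ?] := concl_lift cv.
  have [[|f [|f' []]] //= [ef ef'] pv'] := prem_lift pv.
  by exists f, f'; split=> //=; rewrite ef ef'.
- case=> [eL [eR [e [pv cv le]]]].
  have [fL [fR [f [pv' cv' [eqL eqR eqe]]]]] := lift3 _ _ _ pv cv.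
  by exists fL, fR, f; split=> //=; rewrite eqL eqR eqe.
- case=> [eL [eR [e [pv cv le]]]].
  have [fL [fR [f [pv' cv' [eqL eqR eqe]]]]] := lift3 _ _ _ pv cv.
  by exists fL, fR, f; split=> //=; rewrite eqL eqR eqe.
case=> [e pv]; split; first by have [[|//] _ ?] := concl_lift cv.
by have [[|f []] //= _ pv'] := prem_lift pv; exists f.
Qed.

Definition m_reduct : proof_structure At := ProofStructure m_reduct_wf.

End MReduct.

Variant reduction (p : proof_structure At) : proof_structure At -> Type :=
| a_reduction (r : a_redex p) : reduction p (a_reduct r)
| m_reduction (r : m_redex p) : reduction p (m_reduct r).

Definition a_atom (p : proof_structure At) (r : a_redex p)
    (u : U_ps (a_reduct r)) : U_ps p :=
  Tagged (fun e : edge p => uatoms (lab e)) (i := ar_tgt_edge (tag u))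
    (tagged u).

Definition m_atom (p : proof_structure At) (r : m_redex p)
    (u : U_ps (m_reduct r)) : U_ps p :=
  Tagged (fun e : edge p => uatoms (lab e)) (i := val (tag u)) (tagged u).

(* The action of $T_\gamma$ on atoms: an atom on the new edge of an a-reduct is
   sent to the same position on [e3], every other one to itself. *)
Definition T_atom (p p' : proof_structure At) (c : reduction p p') :
    U_ps p' -> U_ps p :=
  match c with
  | a_reduction r => @a_atom p r
  | m_reduction r => @m_atom p r
  end.

Definition T_map (k : fieldType) (p p' : proof_structure At)
    (c : reduction p p') : {lrmorphism P_ps k p' -> P_ps k p} :=
  poly_eval (fun u => pvar k (T_atom c u)).

End Reduction.

(* Main.v *)
Require Import Defs.
From mathcomp Require Import all_boot all_algebra.
From mathcomp Require Import finmap.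
From mathcomp.multinomials Require Import monalg.
From mathcomp Require Import zify.

(** The morphism [T] of a reduction from [p] to [p'] has a left inverse: a
morphism [S] of algebras from the polynomials of [p] to those of [p'] that
sends atoms to atoms.  If both [T] and [S] send generators of one ideal into
the other ideal, then [f] is in the ideal of [p'] if and only if [T f] is in
the ideal of [p] ([ideal_gen_retract]): forwards apply [T], backwards apply [S]
and [S (T f) = f].  All three claims of the theorem follow, so everything
rests on [reduction_retraction], which provides [S].

To define [S], an atom that disappears is replaced by an atom of the reduct to
which the links of the redex force it to be equal.

For an a-redex, atoms on [e1] and [e3] become the corresponding atoms on the
new edge and atoms on [e2] become the matching ones, in reverse order.  Then [S]
kills the generators of the two links of the redex.  In the other direction, a
link of the reduct whose conclusion is the new edge had the conclusion [e1],
while [T] uses [e3]; the atoms of [e1] and [e3] are congruent through those of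
[e2].

For an m-redex, an atom on the conclusion of the tensor or of the par becomes
the atom of the premise that it comes from.  Then [S] kills the generators of
these two links, and sends the generators of the cut to generators of the two
new cuts: position [n] of [A] faces position [|B| + n'] of the conclusion of the
par exactly when it faces position [n'] of [neg A].  Conversely the generators
of the new cuts are, modulo the ideal of [p], those of the old cut.

Links away from the redex are the same on both sides; [link_transport] deals
with them for [T] and [S] and for both kinds of redex. *)

Set Implicit Arguments.
Unset Strict Implicit.
Unset Printing Implicit Defensive.

Import GRing.Theory.

Local Open Scope ring_scope.

(** * Generated ideals and retractions *)

Section GeneratedIdeal.
Context (R : comNzRingType) (S : R -> Prop).
Implicit Types (f g h : R).

Lemma ideal_gen0 : ideal_gen S 0.
Proof.
by exists 0%N, (fun=> 0), (fun=> 0); split=> [[]//|]; rewrite big_ord0.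
Qed.

Lemma ideal_gen_mem g : S g -> ideal_gen S g.
Proof.
by move=> Sg; exists 1%N, (fun=> 1), (fun=> g); rewrite big_ord1 mul1r.
Qed.

Lemma ideal_genD f g : ideal_gen S f -> ideal_gen S g -> ideal_gen S (f + g).
Proof.
move=> [m [c [s [Ss ->]]]] [n [d [t [St ->]]]].
pose glue (a : 'I_m -> R) (b : 'I_n -> R) i :=
  match split i with inl j => a j | inr j => b j end.
exists (m + n)%N, (glue c d), (glue s t); split.
  by move=> i; rewrite /glue; case: (split i).
rewrite big_split_ord /glue; congr (_ + _); apply: eq_bigr => i _.
  by rewrite (unsplitK (inl i)).
by rewrite (unsplitK (inr i)).
Qed.

Lemma ideal_genM a f : ideal_gen S f -> ideal_gen S (a * f).
Proof.
move=> [n [c [s [Ss ->]]]]; exists n, (fun i => a * c i), s; split=> //.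
by rewrite big_distrr /=; apply: eq_bigr => i _; rewrite mulrA.
Qed.

Lemma ideal_genN f : ideal_gen S f -> ideal_gen S (- f).
Proof. by rewrite -mulN1r; apply: ideal_genM. Qed.

Definition cong f g := ideal_gen S (f - g).

Lemma cong_refl f : cong f f.
Proof. by rewrite /cong subrr; apply: ideal_gen0. Qed.

Lemma cong_sym f g : cong f g -> cong g f.
Proof. by move=> /ideal_genN; rewrite opprB. Qed.

Lemma cong_trans f g h : cong f g -> cong g h -> cong f h.
Proof. by move=> fg /(ideal_genD fg); rewrite addrA subrK. Qed.

End GeneratedIdeal.

Lemma ideal_gen_rmorph (R R' : comNzRingType) (phi : {rmorphism R -> R'})
    (S : R -> Prop) (S' : R' -> Prop) :
  (forall g, S g -> ideal_gen S' (phi g)) ->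
  forall f, ideal_gen S f -> ideal_gen S' (phi f).
Proof.
move=> SS' _ [n [c [s [Ss ->]]]]; rewrite rmorph_sum /=.
apply: (big_ind (ideal_gen S')); [exact: ideal_gen0|exact: ideal_genD|].
by move=> i _; rewrite rmorphM; apply/ideal_genM/SS'.
Qed.

(** The reason why the contraction of [I] along [phi] is [I']: the left inverse
[psi] brings membership back. *)
Lemma ideal_gen_retract (R R' : comNzRingType) (S : R -> Prop)
    (S' : R' -> Prop) (phi : {rmorphism R' -> R}) (psi : {rmorphism R -> R'}) :
  cancel phi psi ->
  (forall g, S' g -> ideal_gen S (phi g)) ->
  (forall g, S g -> ideal_gen S' (psi g)) ->
  forall f, ideal_gen S' f <-> ideal_gen S (phi f).
Proof.
move=> phiK phiS psiS f; split; first exact: ideal_gen_rmorph.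
by move=> /(ideal_gen_rmorph psiS); rewrite phiK.
Qed.

(** * Endomorphisms of free algebras *)

Section Polynomials.
Context (k : fieldType).

Lemma malgUM (I : choiceType) (m1 m2 : {cmonom I}) :
  << mmul m1 m2 >> = << m1 >> * << m2 >> :> freealg k I.
Proof. by rewrite malgM_def fgmulUU mulr1. Qed.

Lemma poly_evalC (I J : choiceType) (h : I -> freealg k J) c :
  poly_eval h c%:MP = c%:MP.
Proof. by rewrite /poly_eval mmapC. Qed.

(** Universal property of the free algebra, in the only case needed to check
that one substitution undoes another. *)
Lemma rmorph_freealg_id (I : choiceType)
    (phi : {rmorphism freealg k I -> freealg k I}) :
  (forall c, phi c%:MP = c%:MP) -> (forall i, phi (pvar k i) = pvar k i) ->
  phi =1 id.
Proof.
move=> phiC phiX f; rewrite [f]monalgE rmorph_sum; apply: eq_bigr => m _.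
have -> : << f@_m *g m >> = (f@_m)%:MP * << m >>.
  by rewrite malgM_def fgmulUU mulr1 mul1m.
suff E : phi << m >> = << m >>.
  (* A term, since rewriting with [phiC] would compare the unfoldings of
     [c%:MP] and [<< m >>]. *)
  exact: etrans (rmorphM phi _ _) (f_equal2 *%R (phiC _) E).
have [n] := ubnP (mdeg m); elim: n m => // n IH m.
have [->|nm1] := eqVneq m mone; first by rewrite rmorph1.
have [i im] : exists i, i \in finsupp m.
  apply/fset0Pn; apply: contraNneq nm1 => m0.
  by apply/cmP => i; rewrite cm1; apply/eqP; rewrite cmE_eq0 m0 inE.
have {im} -> : m = mmul (ucm i) (divcm m (ucm i)).
  apply/eqP/cmP => j; rewrite cmM divcmE ucmE.
  have [<-|_] := eqVneq i j; last by rewrite subn0.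
  by rewrite subnKC // lt0n cmE_neq0.
rewrite mdegM mdegU add1n ltnS => /IH E.
rewrite malgUM.
exact: etrans (rmorphM phi _ _) (f_equal2 *%R (phiX i) E).
Qed.

End Polynomials.

(** * Atoms by position, and the generators of a link *)

Section AtomOccurrences.
Context (At : choiceType) (k : fieldType).
Implicit Types (G : graph At).

Notation width e := (size (atoms (lab e))).

(** The variable of the atom at position [n] of the label of [e].  A plain
natural number, instead of an ordinal whose bound depends on [lab e], allows
rewriting with equations between edges and between labels; the value outside
the range is arbitrary. *)
Definition occ G (e : edge G) (n : nat) : P_ps k G :=
  if insub n is Some x then X_at k (x : uatoms (lab e)) else 0.

Lemma occE G (e : edge G) (x : uatoms (lab e)) : occ e x = X_at k x.
Proof. by rewrite /occ valK. Qed.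

Lemma occ_pvar G (e : edge G) n (lt : (n < width e)%N) :
  occ e n = pvar k (Tagged (fun e => uatoms (lab e)) (Ordinal lt) : U_ps G).
Proof. by rewrite -[n]/(val (Ordinal lt)) occE. Qed.

Lemma poly_eval_occ G (R : choiceType) (h : U_ps G -> freealg k R) e n
    (lt : (n < width e)%N) :
  poly_eval h (occ e n) =
  h (Tagged (fun e => uatoms (lab e)) (Ordinal lt) : U_ps G).
Proof. by rewrite occ_pvar poly_eval_pvar. Qed.

(** The substitution that moves position [n] of the edge [e] to the position
[(f e n).2] of the edge [(f e n).1]. *)
Definition rename G (H : graph At) (f : edge G -> nat -> edge H * nat)
    : {lrmorphism P_ps k G -> P_ps k H} :=
  poly_eval (fun u : U_ps G =>
    let e := f (tag u) (val (tagged u)) in occ e.1 e.2).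

Lemma rename_occ G H (f : edge G -> nat -> edge H * nat) e n :
  (n < width e)%N -> rename f (occ e n) = occ (f e n).1 (f e n).2.
Proof. by move=> lt; rewrite /rename /= poly_eval_occ. Qed.

Definition occ_cong G := cong (@G_ps At k G).

Definition matched G (l : vert G) e e' :=
  (vlab l = Ax /\ conclusions l [:: e; e']) \/
  (vlab l = Cut /\ premises l [:: e; e']).

Definition binary G (l : vert G) eL eR e :=
  [/\ vlab l = Tens \/ vlab l = Par, lr_premises l eL eR
    & conclusions l [:: e]].

(** The generators of a link with all labels replaced by what is used about
them: widths, and negation at axioms and cuts. *)
Variant link_generator G (l : vert G) : P_ps k G -> Prop :=
| MatchGenerator e e' n n' of matched l e e' & lab e' = neg (lab e)
    & (n + n').+1 = width e : link_generator l (occ e n - occ e' n')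
| LeftGenerator eL eR e n of binary l eL eR e
    & (n < width eL)%N & (n < width e)%N :
    link_generator l (occ eL n - occ e n)
| RightGenerator eL eR e n of binary l eL eR e
    & (n < width eR)%N & (width eL + n < width e)%N :
    link_generator l (occ eR n - occ e (width eL + n)).

Lemma G_linkP G (l : vert G) g : G_link l g -> link_generator l g.
Proof.
have binP eL eR e : binary l eL eR e ->
    (exists (x : uatoms (lab eL)) (x' : uatoms (lab e)),
      x' = x :> nat /\ g = X_at k x - X_at k x') \/
    (exists (y : uatoms (lab eR)) (y' : uatoms (lab e)),
      y' = (width eL + y)%N :> nat /\ g = X_at k y - X_at k y') ->
    link_generator l g.
  move=> lb [] [x [x' [xx' ->]]]; rewrite -!occE xx'.
    by apply: LeftGenerator lb _ _; [|rewrite -xx']; apply: ltn_ord.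
  by apply: RightGenerator lb _ _; [|rewrite -xx']; apply: ltn_ord.
rewrite /G_link; case lE: (vlab l) => //.
- move=> [e [e' [cl le [x [x' [xx' ->]]]]]]; rewrite -!occE.
  by apply: MatchGenerator => //; left.
- move=> [e [e' [pl le [x [x' [xx' ->]]]]]]; rewrite -!occE.
  by apply: MatchGenerator => //; right.
- by move=> [eL [eR [e [pl cl /binP]]]]; apply; split=> //; left.
by move=> [eL [eR [e [pl cl /binP]]]]; apply; split=> //; right.
Qed.

Lemma link_generator_mem G (l : vert G) g : link_generator l g -> I_ps g.
Proof.
case=> {g} [e e' n n' lP le nn'|eL eR e n [lP pl cl] lt lt'
           |eL eR e n [lP pl cl] lt lt']; apply: ideal_gen_mem; exists l.
- have lt : (n < width e)%N by rewrite -nn' ltnS leq_addr.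
  have lt' : (n' < width e')%N.
    by rewrite le size_atoms_neg -nn' ltnS leq_addl.
  rewrite (occ_pvar lt) (occ_pvar lt').
  have E : G_match e e' (X_at k (Ordinal lt : uatoms (lab e)) -
      X_at k (Ordinal lt' : uatoms (lab e'))).
    by exists (Ordinal lt), (Ordinal lt').
  by rewrite /G_link; case: lP => -[-> eP]; exists e, e'.
- rewrite (occ_pvar lt) (occ_pvar lt').
  by rewrite /G_link; case: lP => ->; exists eL, eR, e; split=> //; left;
    exists (Ordinal lt), (Ordinal lt').
rewrite (occ_pvar lt) (occ_pvar lt').
by rewrite /G_link; case: lP => ->; exists eL, eR, e; split=> //; right;
  exists (Ordinal lt), (Ordinal lt').
Qed.

Lemma link_cong G (l : vert G) (a b : P_ps k G) :
  link_generator l (a - b) -> occ_cong a b.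
Proof. exact: link_generator_mem. Qed.

Section LinkTransport.
Context (G H : graph At) (phi : {rmorphism P_ps k G -> P_ps k H}).

(** An axiom or cut lists its two edges in either order, which changes only the
sign of the generators, so it suffices to consider one order. *)
Lemma matched_link_transport (l : vert G) e1 e2 :
    matched l e1 e2 ->
    width e1 = width e2 ->
    (forall n n', (n + n').+1 = width e1 ->
      occ_cong (phi (occ e1 n)) (phi (occ e2 n'))) ->
  forall g, G_link l g -> I_ps (phi g).
Proof.
move=> l12 w12 phi12 g /G_linkP[].
- move=> e e' n n' lee' _; rewrite rmorphB => nn'.
  have [] : (e = e1 /\ e' = e2) \/ (e = e2 /\ e' = e1).
    have [ee' e'e ne] :
        [/\ e \in [:: e1; e2], e' \in [:: e1; e2] & e != e'].
      by case: l12 lee' => -[v1 [_ P1]] [] [v2 [u P2]];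
        [|by rewrite v1 in v2|by rewrite v1 in v2|];
        rewrite !P1 -!P2 !inE !eqxx orbT; move: u; rewrite /= inE andbT.
    move: ee' e'e ne; rewrite !inE.
    by move=> /orP[]/eqP-> /orP[]/eqP->; rewrite ?eqxx // => _; [left|right].
  + move=> [? ?]; subst; exact: phi12.
  move=> [? ?]; subst; apply: cong_sym; apply: phi12.
  by rewrite w12 -nn' addnC.
- move=> eL eR e n [[]v _ _]; by case: l12 => -[]; rewrite v.
move=> eL eR e n [[]v _ _]; by case: l12 => -[]; rewrite v.
Qed.

(** The left and right premises of a binary link and its conclusion are
determined by the link, so its generators are those for one known triple. *)
Lemma binary_link_transport (l : vert G) eL eR e :
    binary l eL eR e ->
    (forall n, (n < width eL)%N ->
      occ_cong (phi (occ eL n)) (phi (occ e n))) ->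
    (forall n, (n < width eR)%N ->
      occ_cong (phi (occ eR n)) (phi (occ e (width eL + n)))) ->
  forall g, G_link l g -> I_ps (phi g).
Proof.
move=> lLR phiL phiR g.
have lU fL fR f : binary l fL fR f -> [/\ fL = eL, fR = eR & f = e].
  case: lLR => _ [[_ P] lL lR] [_ cP] [_ [[_ P'] lL' lR'] [_ cP']].
  have fLP : fL \in [:: eL; eR] by rewrite P -P' !inE eqxx.
  have fRP : fR \in [:: eL; eR] by rewrite P -P' !inE eqxx orbT.
  have fe : f = e by apply/eqP; rewrite -mem_seq1 cP -cP' inE eqxx.
  split=> //.
    by move: fLP lL'; rewrite !inE => /orP[]/eqP-> //; rewrite (negPf lR).
  by move: fRP lR'; rewrite !inE => /orP[]/eqP-> //; rewrite lL.
case/G_linkP=> [f f' n n' [[v _]|[v _]]|fL fR f n lf lt _|fL fR f n lf lt _].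
- by case: lLR => -[]; rewrite v.
- by case: lLR => -[]; rewrite v.
- by rewrite rmorphB; case/lU: lf lt => -> _ ->; apply: phiL.
by rewrite rmorphB; case/lU: lf lt => -> -> ->; apply: phiR.
Qed.

(** For a link [l] that survives as [l'].  Premises and conclusions are mapped
separately since the new edge of an a-reduct stands for [e3] at its target and
for [e1] at its source.  Congruence, rather than equality, is what is available
for [e1]. *)
Lemma link_transport (l : vert G) (l' : vert H) (fp fc : edge G -> edge H) :
    vlab l' = vlab l ->
    (forall s, premises l s -> premises l' (map fp s)) ->
    (forall s, conclusions l s -> conclusions l' (map fc s)) ->
    (forall e, tgt e = l -> [/\ lab (fp e) = lab e,
      prem_left (fp e) = prem_left e &
      forall n, (n < width e)%N -> occ_cong (phi (occ e n)) (occ (fp e) n)]) ->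
    (forall e, src e = l -> lab (fc e) = lab e /\
      forall n, (n < width e)%N -> occ_cong (phi (occ e n)) (occ (fc e) n)) ->
  forall g, G_link l g -> I_ps (phi g).
Proof.
move=> vl fpP fcP phip phic.
have cP s e : conclusions l s -> e \in s -> lab (fc e) = lab e /\
    forall n, (n < width e)%N -> occ_cong (phi (occ e n)) (occ (fc e) n).
  by move=> [_ ->] /eqP; apply: phic.
have pP s e : premises l s -> e \in s -> [/\ lab (fp e) = lab e,
      prem_left (fp e) = prem_left e &
      forall n, (n < width e)%N -> occ_cong (phi (occ e n)) (occ (fp e) n)].
  by move=> [_ ->] /eqP; apply: phip.
have glue (a b : P_ps k G) (a' b' : P_ps k H) :
    occ_cong (phi a) a' -> occ_cong (phi b) b' -> occ_cong a' b' ->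
    I_ps (phi (a - b)).
  move=> aa' bb' ab; rewrite rmorphB.
  exact: cong_trans aa' (cong_trans ab (cong_sym bb')).
have binP eL eR e : binary l eL eR e -> binary l' (fp eL) (fp eR) (fc e).
  move=> [lP [pl lL lR] cl]; split; [by rewrite vl| |exact: fcP cl].
  split; first exact: fpP pl.
    by have [|_ ->] := pP _ eL pl; rewrite ?inE ?eqxx.
  by have [|_ ->] := pP _ eR pl; rewrite ?inE ?eqxx ?orbT.
move=> g /G_linkP[].
- move=> e e' n n' lP le nn'.
  have lt : (n < width e)%N by rewrite -nn' ltnS leq_addr.
  have lt' : (n' < width e')%N.
    by rewrite le size_atoms_neg -nn' ltnS leq_addl.
  case: lP => -[v eP].
    have [|lf cf] := cP _ e eP; rewrite ?inE ?eqxx //.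
    have [|lf' cf'] := cP _ e' eP; rewrite ?inE ?eqxx ?orbT //.
    apply: glue (cf _ lt) (cf' _ lt') _; apply: (@link_generator_mem _ l').
    apply: MatchGenerator; rewrite ?lf ?lf' //; left.
    by rewrite vl; split=> //; apply: fcP eP.
  have [|lf _ cf] := pP _ e eP; rewrite ?inE ?eqxx //.
  have [|lf' _ cf'] := pP _ e' eP; rewrite ?inE ?eqxx ?orbT //.
  apply: glue (cf _ lt) (cf' _ lt') _; apply: (@link_generator_mem _ l').
  apply: MatchGenerator; rewrite ?lf ?lf' //; right.
  by rewrite vl; split=> //; apply: fpP eP.
- move=> eL eR e n lP lt lt'; have := binP _ _ _ lP.
  case: lP => _ [pl _ _] cl lP'.
  have [|lf _ cf] := pP _ eL pl; rewrite ?inE ?eqxx //.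
  have [|lf' cf'] := cP _ e cl; rewrite ?inE ?eqxx //.
  apply: glue (cf _ lt) (cf' _ lt') _; apply: (@link_generator_mem _ l').
  by apply: LeftGenerator lP' _ _; rewrite ?lf ?lf'.
move=> eL eR e n lP lt lt'; have := binP _ _ _ lP.
case: lP => _ [pl _ _] cl lP'.
have [|lfL _ _] := pP _ eL pl; rewrite ?inE ?eqxx //.
have [|lf _ cf] := pP _ eR pl; rewrite ?inE ?eqxx ?orbT //.
have [|lf' cf'] := cP _ e cl; rewrite ?inE ?eqxx //.
apply: glue (cf _ lt) (cf' _ lt') _; apply: (@link_generator_mem _ l').
by rewrite -lfL; apply: RightGenerator lP' _ _; rewrite ?lf ?lf' ?lfL.
Qed.

End LinkTransport.
End AtomOccurrences.

(** Serves for premises ([t] is the target map) and for conclusions ([t] is the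
source map): mutually inverse maps between the edges at [v] and at [v'] carry a
list of the former to a list of the latter. *)
Lemma incident_map (E E' V V' : eqType) (t : E -> V) (t' : E' -> V') v v'
    (f : E -> E') (f' : E' -> E) s :
    (forall e, t e = v -> t' (f e) = v' /\ f' (f e) = e) ->
    (forall e, t' e = v' -> t (f' e) = v /\ f (f' e) = e) ->
    uniq s /\ (forall e, (e \in s) = (t e == v)) ->
  uniq (map f s) /\ (forall e, (e \in map f s) = (t' e == v')).
Proof.
move=> fP f'P [us sP]; have sK : {in s, cancel f f'}.
  by move=> e; rewrite sP => /eqP/fP[].
split=> [|e]; first by rewrite map_inj_in_uniq //; apply: can_in_inj sK.
apply/mapP/eqP => [[e0 + ->]|/f'P[te fK]]; first by rewrite sP => /eqP/fP[].
by exists (f' e); rewrite ?sP ?te.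
Qed.

(** * The retraction of a reduction *)

Section Reductions.
Context (At : choiceType) (k : fieldType).

Notation width e := (size (atoms (lab e))).

Lemma poly_eval_cancel (G H : graph At) (t : U_ps G -> P_ps k H)
    (s : U_ps H -> P_ps k G) :
  (forall e n, (n < width e)%N ->
    poly_eval s (poly_eval t (occ k e n)) = occ k e n) ->
  cancel (poly_eval t) (poly_eval s).
Proof.
move=> stK.
apply: (@rmorph_freealg_id k (U_ps G) (poly_eval s \o poly_eval t)).
  move=> c.
  exact: etrans (congr1 (poly_eval s) (poly_evalC t c)) (poly_evalC s c).
move=> [e x]; have /= := stK e x (ltn_ord x).
by rewrite occE.
Qed.

Section AReduction.
Context (p : proof_structure At) (r : a_redex p).

Let e1 := ar_e1 r.
Let e2 := ar_e2 r.
Let e3 := ar_e3 r.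
Let w := size (atoms (ar_A r)).
Let p' := a_reduct r.
Let T : {rmorphism P_ps k p' -> P_ps k p} := T_map k (a_reduction r).

(** The three edges of the redex are sent to the new edge [None]. *)
Definition a_edge (e : edge p) : edge p' := insub e.

Definition a_occ (e : edge p) (n : nat) : edge p' * nat :=
  if e == e2 then (None, (w - n.+1)%N) else (a_edge e, n).

Let S : {rmorphism P_ps k p -> P_ps k p'} := rename k a_occ.

Let S_rename e n : (n < width e)%N ->
  S (occ k e n) = occ k (a_occ e n).1 (a_occ e n).2.
Proof. exact: rename_occ. Qed.

Let wn (e : edge p) : e \in [:: e1; e2; e3] -> width e = w.
Proof.
by rewrite !inE => /or3P[]/eqP->;
  rewrite ?(ar_lab1 r) ?(ar_lab2 r) ?(ar_lab3 r) ?size_atoms_neg.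
Qed.

Let T_occ (e : edge p') n : (n < width e)%N ->
  T (occ k e n) = occ k (ar_tgt_edge e) n.
Proof.
move=> lt; rewrite (occ_pvar k lt) /T /= poly_eval_pvar.
by rewrite (@occ_pvar _ k p (ar_tgt_edge e) n lt).
Qed.

Let a_edgeK_tgt e : e != e1 -> e != e2 -> ar_tgt_edge (a_edge e) = e.
Proof.
move=> n1 n2; rewrite /a_edge /ar_tgt_edge; case: insubP => [u _ <-//|] /=.
by rewrite !inE (negPf n1) (negPf n2) negbK => /eqP.
Qed.

Let a_edgeK_src e : e != e2 -> e != e3 -> ar_src_edge (a_edge e) = e.
Proof.
move=> n2 n3; rewrite /a_edge /ar_src_edge; case: insubP => [u _ <-//|] /=.
by rewrite !inE (negPf n2) (negPf n3) negbK !orbF => /eqP.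
Qed.

Let tgtK (e : edge p') : a_edge (ar_tgt_edge e) = e.
Proof.
rewrite /a_edge; case: e => [u|] /=; first by rewrite valK.
by rewrite insubF // !inE eqxx !orbT.
Qed.

Let srcK (e : edge p') : a_edge (ar_src_edge e) = e.
Proof.
rewrite /a_edge; case: e => [u|] /=; first by rewrite valK.
by rewrite insubF // !inE eqxx.
Qed.

Let tgt_neq2 (e : edge p') : ar_tgt_edge e != e2.
Proof.
case: e => [u|] /=.
  by have := valP u; rewrite !inE !negb_or => /and3P[].
by have [] := ar_concl_ax r; rewrite /= inE andbT eq_sym.
Qed.

Let lab_edge e : e != e2 -> lab (a_edge e) = lab e.
Proof.
move=> n2; have [->|n1] := eqVneq e e1; last by rewrite /= a_edgeK_tgt.
rewrite /a_edge insubF ?inE ?eqxx //= -/e1.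
by rewrite (ar_lab3 r) (ar_lab1 r).
Qed.

Let neq_cut l (e : edge p) :
  l != ar_cut r -> tgt e = l -> (e != e1) && (e != e2).
Proof.
move=> nl te; move: nl; rewrite -te; have [_ <-] := ar_prem_cut r.
by rewrite !inE negb_or.
Qed.

Let neq_ax l (e : edge p) :
  l != ar_ax r -> src e = l -> (e != e2) && (e != e3).
Proof.
move=> nl te; move: nl; rewrite -te; have [_ <-] := ar_concl_ax r.
by rewrite !inE negb_or.
Qed.

Let S_occ e n : e != e2 -> (n < width e)%N ->
  S (occ k e n) = occ k (a_edge e) n.
Proof. by move=> n2 lt; rewrite S_rename // /a_occ (negPf n2). Qed.

Lemma a_cancel : cancel T S.
Proof.
apply: poly_eval_cancel => e n lt.
have -> : poly_eval (fun u => pvar k (T_atom (a_reduction r) u)) (occ k e n) =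
  occ k (ar_tgt_edge e) n by exact: T_occ.
by rewrite -[LHS]/(S _) S_occ ?tgtK ?tgt_neq2.
Qed.

(** For the new edge, whose ends are [e1] and [e3]: the axiom identifies
position [n] of [e3] with position [w - n.+1] of [e2], and the cut identifies
the latter with position [n] of [e1]. *)
Let src_tgt (e : edge p') n : (n < width e)%N ->
  occ_cong (occ k (ar_tgt_edge e) n) (occ k (ar_src_edge e) n).
Proof.
case: e => [u|] lt; first exact: cong_refl.
have w3 : width e3 = w by rewrite wn ?inE ?eqxx ?orbT.
have w1 : width e1 = w by rewrite wn ?inE ?eqxx ?orbT.
have ltw : (n < w)%N by rewrite -w3.
apply: (@cong_trans _ _ _ (occ k e2 (w - n.+1))).
  apply: (@link_generator_mem _ _ _ (ar_ax r)); apply: MatchGenerator.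
  - left; split; first exact: ar_vlab_ax.
    have [/= + P] := ar_concl_ax r; rewrite !inE andbT => u; split.
      by rewrite /= !inE andbT eq_sym.
    by move=> e; rewrite -P !inE orbC.
  - by rewrite /= (ar_lab2 r) (ar_lab3 r).
  by rewrite /= -/e3 w3; lia.
apply: cong_sym; apply: (@link_generator_mem _ _ _ (ar_cut r)).
apply: MatchGenerator.
- by right; split; [exact: ar_vlab_cut|exact: ar_prem_cut].
- by rewrite /= (ar_lab2 r) (ar_lab1 r).
by rewrite /= -/e1 w1; lia.
Qed.


Lemma a_reduct_generators g : G_ps g -> I_ps (T g).
Proof.
move=> [l gl]; apply: (link_transport (phi := T) (l' := val l)
  (fp := @ar_tgt_edge _ p r) (fc := @ar_src_edge _ p r)) gl => //.
- move=> s; apply: (@incident_map _ _ _ _ _ _ _ _ _ a_edge) => e.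
    by move=> <-; rewrite tgtK.
  move=> te; have nl : val l != ar_cut r.
    by have := valP l; rewrite !inE negb_or => /andP[].
  have /andP[n1 n2] := neq_cut nl te.
  by split; [apply: val_inj|]; rewrite /= a_edgeK_tgt.
- move=> s; apply: (@incident_map _ _ _ _ _ _ _ _ _ a_edge) => e.
    by move=> <-; rewrite srcK.
  move=> te; have nl : val l != ar_ax r.
    by have := valP l; rewrite !inE negb_or => /andP[].
  have /andP[n2 n3] := neq_ax nl te.
  by split; [apply: val_inj|]; rewrite /= a_edgeK_src.
- by move=> e _; split=> // n lt; rewrite T_occ //; apply: cong_refl.
move=> e _; split; last by move=> n lt; rewrite T_occ //; apply: src_tgt.
by case: e => //=; rewrite (ar_lab1 r) (ar_lab3 r).
Qed.

Lemma a_redex_generators g : G_ps g -> I_ps (S g).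
Proof.
have e12 : e1 != e2 by have [] := ar_prem_cut r; rewrite /= inE andbT.
have e32 : e3 != e2 by have [] := ar_concl_ax r; rewrite /= inE andbT eq_sym.
have w1 : width e1 = w by rewrite wn ?inE ?eqxx ?orbT.
have w2 : width e2 = w by rewrite wn ?inE ?eqxx ?orbT.
have w3 : width e3 = w by rewrite wn ?inE ?eqxx ?orbT.
have aE : a_edge e1 = None by rewrite /a_edge insubF // !inE eqxx.
have aE3 : a_edge e3 = None by rewrite /a_edge insubF // !inE eqxx !orbT.
have S2 n : (n < w)%N -> S (occ k e2 n) = occ k (None : edge p') (w - n.+1).
  by move=> lt; rewrite S_rename ?w2 // /a_occ eqxx.
move=> [l gl]; have [lc|nc] := eqVneq l (ar_cut r).
  apply: (matched_link_transport (phi := S) (e1 := e1) (e2 := e2)) gl.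
  - by right; rewrite lc; split; [exact: ar_vlab_cut|exact: ar_prem_cut].
  - by rewrite w1 w2.
  move=> n n'; rewrite w1 => nn'.
  rewrite S_occ ?w1 ?S2 ?aE //; try lia.
  have -> : (w - n'.+1)%N = n by lia.
  exact: cong_refl.
have [la|na] := eqVneq l (ar_ax r).
  apply: (matched_link_transport (phi := S) (e1 := e2) (e2 := e3)) gl.
  - by left; rewrite la; split; [exact: ar_vlab_ax|exact: ar_concl_ax].
  - by rewrite w2 w3.
  move=> n n'; rewrite w2 => nn'.
  rewrite S2 ?S_occ ?w3 ?aE3 //; try lia.
  have -> : (w - n.+1)%N = n' by lia.
  exact: cong_refl.
have lP : l \notin [:: ar_cut r; ar_ax r] by rewrite !inE negb_or nc.
pose l' : vert p' := Sub l lP.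
apply: (link_transport (phi := S) (l' := l') (fp := a_edge)
  (fc := a_edge)) gl => //.
- move=> s; apply: (@incident_map _ _ _ _ _ _ _ _ _ (@ar_tgt_edge _ p r)) => e.
    move=> te; have /andP[n1 n2] := neq_cut nc te.
    by split; [apply: val_inj|]; rewrite /= a_edgeK_tgt.
  by move=> /(congr1 val) /= te; rewrite tgtK.
- move=> s; apply: (@incident_map _ _ _ _ _ _ _ _ _ (@ar_src_edge _ p r)) => e.
    move=> te; have /andP[n1 n2] := neq_ax na te.
    by split; [apply: val_inj|]; rewrite /= a_edgeK_src.
  by move=> /(congr1 val) /= te; rewrite srcK.
- move=> e te; have /andP[n1 n2] := neq_cut nc te.
  split; [exact: lab_edge|by rewrite /= a_edgeK_tgt|].
  by move=> n lt; rewrite S_occ //; apply: cong_refl.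
move=> e te; have /andP[n2 n3] := neq_ax na te.
split; [exact: lab_edge|].
by move=> n lt; rewrite S_occ //; apply: cong_refl.
Qed.

End AReduction.

Section MReduction.
Context (p : proof_structure At) (r : m_redex p).

Let eT := mr_eT r.
Let eP := mr_eP r.
Let wA := size (atoms (mr_A r)).
Let wB := size (atoms (mr_B r)).
Let p' := m_reduct r.
Let T : {rmorphism P_ps k p' -> P_ps k p} := T_map k (m_reduction r).

Let tgt_cutF e : tgt e = mr_tens r \/ tgt e = mr_par r ->
  e \notin [:: eT; eP].
Proof.
have [_ ->] := mr_prem_cut r => te; apply/eqP => tc; move: te; rewrite tc.
by case=> /(congr1 (@vlab _ p)); rewrite mr_vlab_cut ?mr_vlab_tens ?mr_vlab_par.
Qed.

Let tens_par : mr_tens r != mr_par r.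
Proof.
by apply/eqP => /(congr1 (@vlab _ p)); rewrite mr_vlab_tens mr_vlab_par.
Qed.

Let tgtA : tgt (mr_eA r) = mr_tens r.
Proof.
by have [[_ sP] _ _] := mr_prem_tens r; apply/eqP; rewrite -sP !inE eqxx.
Qed.
Let tgtB : tgt (mr_eB r) = mr_tens r.
Proof.
by have [[_ sP] _ _] := mr_prem_tens r; apply/eqP; rewrite -sP !inE eqxx orbT.
Qed.
Let tgtnA : tgt (mr_enA r) = mr_par r.
Proof.
by have [[_ sP] _ _] := mr_prem_par r; apply/eqP; rewrite -sP !inE eqxx orbT.
Qed.
Let tgtnB : tgt (mr_enB r) = mr_par r.
Proof.
by have [[_ sP] _ _] := mr_prem_par r; apply/eqP; rewrite -sP !inE eqxx.
Qed.

Definition m_premA : edge p' := Sub (mr_eA r) (tgt_cutF (or_introl tgtA)).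
Definition m_premB : edge p' := Sub (mr_eB r) (tgt_cutF (or_introl tgtB)).
Definition m_premnA : edge p' := Sub (mr_enA r) (tgt_cutF (or_intror tgtnA)).
Definition m_premnB : edge p' := Sub (mr_enB r) (tgt_cutF (or_intror tgtnB)).

(** The default value concerns only the two deleted edges, to which [m_occ] does
not apply [m_edge]. *)
Definition m_edge (e : edge p) : edge p' := insubd m_premA e.

Definition m_occ (e : edge p) (n : nat) : edge p' * nat :=
  if e == eT then
    if (n < wA)%N then (m_premA, n) else (m_premB, (n - wA)%N)
  else if e == eP then
    if (n < wB)%N then (m_premnB, n) else (m_premnA, (n - wB)%N)
  else (m_edge e, n).

Let S : {rmorphism P_ps k p -> P_ps k p'} := rename k m_occ.

Let S_rename e n : (n < width e)%N ->
  S (occ k e n) = occ k (m_occ e n).1 (m_occ e n).2.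
Proof. exact: rename_occ. Qed.

Let m_edgeK e : e \notin [:: eT; eP] -> val (m_edge e) = e.
Proof. by move=> eQ; rewrite /m_edge val_insubd eQ. Qed.

Let valK' (e : edge p') : m_edge (val e) = e.
Proof. exact: valKd. Qed.

Let T_occ (e : edge p') n : (n < width e)%N ->
  T (occ k e n) = occ k (val e) n.
Proof.
move=> lt; rewrite (occ_pvar k lt) /T /= poly_eval_pvar.
by rewrite (@occ_pvar _ k p (val e) n lt).
Qed.

Let S_occ e n : e \notin [:: eT; eP] -> (n < width e)%N ->
  S (occ k e n) = occ k (m_edge e) n.
Proof.
rewrite !inE negb_or => /andP[nT nP] lt.
by rewrite S_rename // /m_occ (negPf nT) (negPf nP).
Qed.

Lemma m_cancel : cancel T S.
Proof.
apply: poly_eval_cancel => e n lt.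
have -> : poly_eval (fun u => pvar k (T_atom (m_reduction r) u)) (occ k e n) =
  occ k (val e) n by exact: T_occ.
by rewrite -[LHS]/(S _) S_occ ?valK' //; exact: (valP e).
Qed.

Let tgt_m_prem :
  [/\ tgt m_premA = inr true, tgt m_premnA = inr true,
      tgt m_premB = inr false & tgt m_premnB = inr false].
Proof.
have nX f g : tgt f = mr_tens r -> tgt g = mr_par r -> (f == g) = false.
  by move=> tf tg; apply: contraNF tens_par => /eqP fg; rewrite -tf -tg fg.
have nAB : (mr_eB r == mr_eA r) = false.
  apply/negP => /eqP E; have [_ lL] := mr_prem_tens r.
  by rewrite E lL.
have nAB' : (mr_enB r == mr_enA r) = false.
  apply/negP => /eqP E; have [_ lL] := mr_prem_par r.
  by rewrite -E lL.
by split; rewrite /= /mr_tgt insubF /= ?tgtA ?tgtB ?tgtnA ?tgtnB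
  !inE ?eqxx ?orbT // ?nAB ?nAB' ?(nX _ _ tgtB tgtnA) // eq_sym
  (nX _ _ tgtA tgtnB).
Qed.

(** An edge that loses its target was a premise of the tensor or of the par: the
premises of the cut have been deleted. *)
Let tgt_inr (e : edge p') b : tgt e = inr b ->
  e \in [:: m_premA; m_premnA; m_premB; m_premnB].
Proof.
rewrite /= /mr_tgt; case: insubP => // nt _; move: nt.
rewrite negbK !inE -!val_eqE /=; have [_ <-] := mr_prem_cut r.
rewrite (negPf (valP e)) /=.
have [[_ <-] _ _] := mr_prem_tens r; have [[_ <-] _ _] := mr_prem_par r.
by rewrite !inE => /orP[]/orP[]->; rewrite ?orbT.
Qed.

Let matchedA : matched (inr true : vert p') m_premA m_premnA.
Proof.
have [tA tnA tB tnB] := tgt_m_prem.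
right; split=> //; split.
  rewrite /= inE andbT -val_eqE /=.
  by apply: contraNneq tens_par => E; rewrite -tgtA -tgtnA E.
move=> e; apply/idP/eqP.
  by rewrite !inE => /orP[]/eqP->.
move=> te; have := tgt_inr te; rewrite !inE.
case/or4P=> /eqP E; rewrite E ?eqxx ?orbT //.
  by move: te; rewrite E tB.
by move: te; rewrite E tnB.
Qed.

Let matchedB : matched (inr false : vert p') m_premB m_premnB.
Proof.
have [tA tnA tB tnB] := tgt_m_prem.
right; split=> //; split.
  rewrite /= inE andbT -val_eqE /=.
  by apply: contraNneq tens_par => E; rewrite -tgtB -tgtnB E.
move=> e; apply/idP/eqP.
  by rewrite !inE => /orP[]/eqP->.
move=> te; have := tgt_inr te; rewrite !inE.
case/or4P=> /eqP E; rewrite E ?eqxx ?orbT //.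
  by move: te; rewrite E tA.
by move: te; rewrite E tnA.
Qed.

Let matchedT : matched (mr_cut r) eT eP.
Proof. by right; split; [exact: mr_vlab_cut|exact: mr_prem_cut]. Qed.

Let binaryT : binary (mr_tens r) (mr_eA r) (mr_eB r) eT.
Proof.
by split; [left; apply: mr_vlab_tens|exact: mr_prem_tens|exact: mr_concl_tens].
Qed.

Let binaryP : binary (mr_par r) (mr_enB r) (mr_enA r) eP.
Proof.
by split; [right; apply: mr_vlab_par|exact: mr_prem_par|exact: mr_concl_par].
Qed.

Let widths : [/\ width (mr_eA r) = wA, width (mr_eB r) = wB &
  [/\ width (mr_enA r) = wA, width (mr_enB r) = wB,
      width eT = (wA + wB)%N & width eP = (wB + wA)%N]].
Proof.
rewrite mr_labA mr_labB mr_labnA mr_labnB (mr_labT r) (mr_labP r).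
by rewrite atoms_tens atoms_par !size_cat !size_atoms_neg.
Qed.

(** A generator of a new cut is a generator of the old cut up to generators of
the tensor and of the par: [A] faces [neg A] and [B] faces [neg B] since the
label of the conclusion of the par lists [neg B] first. *)
Lemma m_reduct_generators g : G_ps g -> I_ps (T g).
Proof.
have [wdA wdB [wdnA wdnB wdT wdP]] := widths.
have labP : lab eP = neg (lab eT).
  by rewrite (mr_labT r) (mr_labP r) neg_tens.
move=> [[l|b] gl].
  apply: (link_transport (phi := T) (l' := val l) (fp := val)
    (fc := val)) gl => //.
  - move=> s; apply: (@incident_map _ _ _ _ _ _ _ _ _ m_edge) => e.
      rewrite valK' /= /mr_tgt; case: insubP => // u _ <- [<-]; by split.
    move=> te; have eQ : e \notin [:: eT; eP].
      have [_ ->] := mr_prem_cut r; rewrite te.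
      by have := valP l; rewrite !inE !negb_or => /and3P[].
    by rewrite m_edgeK //= /mr_tgt m_edgeK // te valK.
  - move=> s; apply: (@incident_map _ _ _ _ _ _ _ _ _ m_edge) => e.
      by rewrite valK' => -[<-].
    move=> te; have eQ : e \notin [:: eT; eP].
      have [_ cT] := mr_concl_tens r; have [_ cP] := mr_concl_par r.
      have := valP l; rewrite !inE !negb_or -te -cT -cP !inE.
      by case/and3P => _ -> ->.
    rewrite m_edgeK //; split=> //; congr inl; apply: val_inj.
    by rewrite /= m_edgeK.
  - by move=> e _; split=> // n lt; rewrite T_occ //; apply: cong_refl.
  by move=> e _; split=> // n lt; rewrite T_occ //; apply: cong_refl.
case: b gl => gl.
  apply: (matched_link_transport (phi := T) matchedA) gl;
    rewrite /= ?wdA ?wdnA //.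
  move=> n n' nn'; rewrite !T_occ /= ?wdA ?wdnA; try lia.
  apply: (@cong_trans _ _ _ (occ k eT n)).
    by apply: link_cong; apply: LeftGenerator binaryT _ _; lia.
  apply: (@cong_trans _ _ _ (occ k eP (wB + n'))).
    by apply: link_cong; apply: MatchGenerator matchedT _ _ => //; lia.
  apply: cong_sym; rewrite -wdnB; apply: link_cong.
  by apply: RightGenerator binaryP _ _; lia.
apply: (matched_link_transport (phi := T) matchedB) gl;
  rewrite /= ?wdB ?wdnB //.
move=> n n' nn'; rewrite !T_occ /= ?wdB ?wdnB; try lia.
apply: (@cong_trans _ _ _ (occ k eT (wA + n))).
  by rewrite -wdA; apply: link_cong; apply: RightGenerator binaryT _ _; lia.
apply: (@cong_trans _ _ _ (occ k eP n')).
  by apply: link_cong; apply: MatchGenerator matchedT _ _ => //; lia.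
apply: cong_sym; apply: link_cong.
by apply: LeftGenerator binaryP _ _; lia.
Qed.

(** A generator of the old cut at position [n] belongs to the cut of [A] if
[n < |A|] and to the cut of [B] otherwise. *)
Lemma m_redex_generators g : G_ps g -> I_ps (S g).
Proof.
have [wdA wdB [wdnA wdnB wdT wdP]] := widths.
have TP : eP != eT by have [/= + _] := mr_prem_cut r; rewrite inE andbT eq_sym.
have S_A n : (n < wA)%N -> S (occ k (mr_eA r) n) = occ k m_premA n.
  move=> lt; rewrite S_occ ?wdA ?(valP m_premA) //.
  by rewrite -[mr_eA r]/(val m_premA) valK'.
have S_B n : (n < wB)%N -> S (occ k (mr_eB r) n) = occ k m_premB n.
  move=> lt; rewrite S_occ ?wdB ?(valP m_premB) //.
  by rewrite -[mr_eB r]/(val m_premB) valK'.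
have S_nA n : (n < wA)%N -> S (occ k (mr_enA r) n) = occ k m_premnA n.
  move=> lt; rewrite S_occ ?wdnA ?(valP m_premnA) //.
  by rewrite -[mr_enA r]/(val m_premnA) valK'.
have S_nB n : (n < wB)%N -> S (occ k (mr_enB r) n) = occ k m_premnB n.
  move=> lt; rewrite S_occ ?wdnB ?(valP m_premnB) //.
  by rewrite -[mr_enB r]/(val m_premnB) valK'.
have S_TA n : (n < wA)%N -> S (occ k eT n) = occ k m_premA n.
  by move=> lt; rewrite S_rename ?wdT /m_occ ?eqxx ?lt //; lia.
have S_TB n : (n < wB)%N -> S (occ k eT (wA + n)) = occ k m_premB n.
  move=> lt; rewrite S_rename ?wdT /m_occ ?eqxx; last by lia.
  by rewrite ltnNge leq_addr /= addKn.
have S_PB n : (n < wB)%N -> S (occ k eP n) = occ k m_premnB n.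
  by move=> lt; rewrite S_rename ?wdP /m_occ ?(negPf TP) ?eqxx ?lt //; lia.
have S_PA n : (n < wA)%N -> S (occ k eP (wB + n)) = occ k m_premnA n.
  move=> lt; rewrite S_rename ?wdP /m_occ ?(negPf TP) ?eqxx; last by lia.
  by rewrite ltnNge leq_addr /= addKn.
move=> [l gl]; have [lc|nc] := eqVneq l (mr_cut r).
  subst l; apply: (matched_link_transport (phi := S) matchedT) gl;
    rewrite wdT ?wdP.
    exact: addnC.
  move=> n n' nn'; have [ltA|geA] := ltnP n wA.
    have [m ltm n'E] : exists2 m, (m < wA)%N & n' = (wB + m)%N.
      by exists (n' - wB)%N; lia.
    rewrite n'E S_TA // S_PA //; apply: (@link_generator_mem _ _ p').
    apply: MatchGenerator matchedA _ _ => /=; first by rewrite mr_labnA mr_labA.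
    by rewrite wdA; lia.
  have [m ltm nE] : exists2 m, (m < wB)%N & n = (wA + m)%N.
    by exists (n - wA)%N; lia.
  rewrite nE S_TB // S_PB; last by lia.
  apply: (@link_generator_mem _ _ p').
  apply: MatchGenerator matchedB _ _ => /=; first by rewrite mr_labnB mr_labB.
  by rewrite wdB; lia.
have [lt|nt] := eqVneq l (mr_tens r).
  subst l; apply: (binary_link_transport (phi := S) binaryT) gl => n;
    rewrite ?wdA ?wdB => lt.
    by rewrite S_A // S_TA //; apply: cong_refl.
  by rewrite S_B // S_TB //; apply: cong_refl.
have [lt|np] := eqVneq l (mr_par r).
  subst l; apply: (binary_link_transport (phi := S) binaryP) gl => n;
    rewrite ?wdnA ?wdnB => lt.
    by rewrite S_nB // S_PB //; apply: cong_refl.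
  by rewrite S_nA // S_PA //; apply: cong_refl.
have lP : l \notin [:: mr_cut r; mr_tens r; mr_par r].
  by rewrite !inE !negb_or nc nt.
have tP e : tgt e = l -> e \notin [:: eT; eP].
  by have [_ ->] := mr_prem_cut r => ->.
have sP e : src e = l -> e \notin [:: eT; eP].
  have [_ cT] := mr_concl_tens r; have [_ cP] := mr_concl_par r.
  by move=> se; move: nt np; rewrite -se -cT -cP !inE negb_or => -> ->.
apply: (link_transport (phi := S) (l' := inl (Sub l lP) : vert p')
  (fp := m_edge) (fc := m_edge)) gl => //.
- move=> s; apply: (@incident_map _ _ _ _ _ _ _ _ _ val) => e.
    move=> te; have eQ := tP _ te; rewrite m_edgeK //=; split=> //.
    by rewrite /mr_tgt m_edgeK // te insubT.
  by rewrite valK' /= /mr_tgt; case: insubP => // u _ <- [->].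
- move=> s; apply: (@incident_map _ _ _ _ _ _ _ _ _ val) => e.
    move=> te; have eQ := sP _ te; rewrite m_edgeK //=; split=> //.
    by congr inl; apply: val_inj; rewrite /= m_edgeK.
  by rewrite valK' => -[].
- move=> e /tP eQ; split; rewrite /= ?m_edgeK // => n lt.
  by rewrite S_occ //; apply: cong_refl.
move=> e /sP eQ; split; rewrite /= ?m_edgeK // => n lt.
by rewrite S_occ //; apply: cong_refl.
Qed.

End MReduction.

Lemma reduction_retraction (p p' : proof_structure At) (c : reduction p p') :
  exists S : {rmorphism P_ps k p -> P_ps k p'},
  [/\ cancel (T_map k c) S, forall g, G_ps g -> I_ps (T_map k c g)
    & forall g, G_ps g -> I_ps (S g)].
Proof.
case: c => r.
  exists (rename k (@a_occ p r)); split.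
  - exact: a_cancel.
  - exact: a_reduct_generators.
  exact: a_redex_generators.
exists (rename k (@m_occ p r)); split.
- exact: m_cancel.
- exact: m_reduct_generators.
exact: m_redex_generators.
Qed.

End Reductions.

Theorem corollary4p7 (At : choiceType)
    (At_infinite : forall s : seq At, exists X : At, X \notin s)
    (k : fieldType) (p p' : proof_structure At) (gamma : reduction p p') :
  [/\ forall f : P_ps k p', I_ps f <-> I_ps (T_map k gamma f),
      injective (T_map k gamma)
    & forall g : P_ps k p,
        (exists2 f : P_ps k p', I_ps f & g = T_map k gamma f) <->
        I_ps g /\ exists f : P_ps k p', g = T_map k gamma f].
Proof.
have [S [TK TI SI]] := reduction_retraction k gamma.
have E := ideal_gen_retract TK TI SI.
split; [exact: E|exact: can_inj TK|].
move=> g; split=> [[f fI ->]|[gI [f gf]]].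
  by split; [apply/E|exists f].
by exists f => //; apply/E; move: gI; rewrite gf.
Qed.
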